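(* Let $\rho$ be an $n$-qubit state with bipartition $A|B$. The $p_\alpha$-negativities satisfy $\mathcal{E}_\alpha(\rho)\ge\mathcal{E}_\beta(\rho)$ for all $0\le\alpha<\beta$ with $\alpha,\beta\ne2$. In particular $\mathcal{E}_\alpha(\rho)\le\mathcal{E}(\rho)$ for every $\alpha\ge1$, $\alpha\neq 2$, so that $\mathcal{E}_\alpha(\rho)>0$ implies $\mathcal{E}(\rho)>0$ and hence that $\rho$ is entangled across $A|B$. Moreover, for every pure state $|\psi\rangle$, $\mathcal{E}_\alpha(|\psi\rangle)=S_{\alpha/2}(|\psi\rangle)$.
   Context: The partial transpose on $B$ is $(X_A\otimes Y_B)^\Gamma=X_A\otimes Y_B^T$; the PT negativity is $\mathcal{E}(\rho)=\ln\|\rho^\Gamma\|_1$. Set $\tilde p_\alpha(\rho)=\mathrm{tr}(|\rho^\Gamma|^\alpha)=\sum_i|\lambda_i|^\alpha$, where the sum runs over nonzero eigenvalues $\lambda_i$ of $\rho^\Gamma$, and $p_2=\mathrm{tr}(\rho^2)$. The $p_\alpha$-negativity is $\mathcal{E}_\alpha(\rho)=\frac{1}{2-\alpha}\ln\tilde p_\alpha+\frac{1-\alpha}{2-\alpha}\ln p_2$ ($\alpha\ne2$), so $\mathcal{E}_1=\mathcal{E}$ and $\mathcal{E}_4=\frac12\ln(p_2^3/p_4)$ with $p_4=\mathrm{tr}((\rho^\Gamma)^4)$. For a pure state, $S_\alpha(|\psi\rangle)=\frac{1}{1-\alpha}\ln\mathrm{tr}(\rho_A^\alpha)$ with $\rho_A=\mathrm{tr}_B|\psi\rangle\langle\psi|$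 is the $\alpha$-Rényi entanglement entropy ($\alpha\to1$ by continuity). *)

(* Defs.v *)
From HB Require Import structures.
From mathcomp Require Import all_boot all_order all_algebra.
From mathcomp Require Import spectral.
From mathcomp Require Import complex.
From mathcomp Require Import reals exp.

Set Implicit Arguments.
Unset Strict Implicit.
Unset Printing Implicit Defensive.

Import Order.TTheory GRing.Theory Num.Theory.

Local Open Scope ring_scope.
Local Open Scope sesquilinear_scope.
Local Open Scope complex_scope.

(* The computational basis of the qubits labelled by I is {ffun I -> bool}.
   Operators on the Hilbert space are matrices over R[i] whose rows and columns
   are numbered by the enumeration of that basis; [entry X x y] is <x|X|y>. *)
Notation bits I := {ffun I -> bool}.
Notation hdim I := #|{: bits I}|.
Notation operator R I := 'M[R[i]]_(hdim I).

Definition entry (R : realType) (I : finType) (X : operator R I)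
  (x y : bits I) : R[i] := X (enum_rank x) (enum_rank y).

Definition operator_of (R : realType) (I : finType)
    (f : bits I -> bits I -> R[i]) : operator R I :=
  \matrix_(i, j) f (enum_val i) (enum_val j).

(* A bipartition A|B of n qubits is given by A : {set 'I_n}, with B := ~: A. *)
Notation qubits S := {k | k \in S}.

Definition restrict_bits (n : nat) (S : {set 'I_n}) (x : bits 'I_n) :
  bits (qubits S) := [ffun k => x (val k)].

(* The bit string (x_A, y_B). *)
Definition mix_bits (n : nat) (A : {set 'I_n}) (x y : bits 'I_n) :
  bits 'I_n := [ffun k => if k \in A then x k else y k].

Section Operators.
Variable R : realType.

(* X_A (x) Y_B *)
Definition tensor (n : nat) (A : {set 'I_n}) (X : operator R (qubits A))
    (Y : operator R (qubits (~: A))) : operator R 'I_n :=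
  operator_of (fun x y =>
    entry X (restrict_bits A x) (restrict_bits A y)
    * entry Y (restrict_bits (~: A) x) (restrict_bits (~: A) y)).

(* <x_A x_B| X^Gamma |y_A y_B> = <x_A y_B| X |y_A x_B> *)
Definition partial_transpose (n : nat) (A : {set 'I_n}) (X : operator R 'I_n) :
    operator R 'I_n :=
  operator_of (fun x y => entry X (mix_bits A x y) (mix_bits A y x)).

Lemma partial_transpose_tensor (n : nat) (A : {set 'I_n})
    (X : operator R (qubits A)) (Y : operator R (qubits (~: A))) :
  partial_transpose A (tensor X Y) = tensor X Y^T.
Proof.
have mixA (x y : bits 'I_n) :
    restrict_bits A (mix_bits A x y) = restrict_bits A x.
  by apply/ffunP => -[k kA]; rewrite !ffunE /= kA.
have mixB (x y : bits 'I_n) :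
    restrict_bits (~: A) (mix_bits A x y) = restrict_bits (~: A) y.
  apply/ffunP => -[k kB]; rewrite !ffunE /=.
  by move: kB; rewrite inE => /negbTE ->.
apply/matrixP => i j; rewrite !mxE /entry !mxE !enum_rankK.
by rewrite !mixA !mixB.
Qed.

(* <a| tr_B X |a'> = sum_b <a b| X |a' b>; the pairs (a b, a' b) are the pairs
   (x, y) of bit strings that extend a and a' and agree on B. *)
Definition partial_trace (n : nat) (A : {set 'I_n}) (X : operator R 'I_n) :
    operator R (qubits A) :=
  operator_of (fun a a' =>
    \sum_x \sum_(y | [&& restrict_bits A x == a, restrict_bits A y == a'
                       & restrict_bits (~: A) x == restrict_bits (~: A) y])
      entry X x y).

Definition is_state (d : nat) (rho : 'M[R[i]]_d) : Prop :=
  [/\ rho \is hermsymmx,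
      (forall v : 'cV[R[i]]_d, 0 <= (v ^t* *m rho *m v) 0 0)
    & \tr rho = 1].

Definition is_unit_vector (d : nat) (psi : 'cV[R[i]]_d) : Prop :=
  psi ^t* *m psi = 1%:M.

Definition ketbra (d : nat) (psi : 'cV[R[i]]_d) : 'M[R[i]]_d :=
  psi *m psi ^t*.

Definition separable (n : nat) (A : {set 'I_n}) (rho : operator R 'I_n) :
    Prop :=
  exists (m : nat) (p : 'I_m -> R) (sA : 'I_m -> operator R (qubits A))
         (sB : 'I_m -> operator R (qubits (~: A))),
    [/\ (forall k, 0 <= p k), \sum_k p k = 1,
        (forall k, is_state (sA k)), (forall k, is_state (sB k))
      & rho = \sum_k (p k)%:C *: tensor (sA k) (sB k)].

Definition entangled (n : nat) (A : {set 'I_n}) (rho : operator R 'I_n) :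
  Prop := ~ separable A rho.

(* ||X||_1 = tr sqrt(X^* X), the sum of the singular values of X. *)
Definition trace_norm (d : nat) (X : 'M[R[i]]_d) : R :=
  \sum_i Num.sqrt (complex.Re (spectral_diag (X ^t* *m X) 0 i)).

(* tr (|X|^alpha) for X Hermitian: [spectral_diag X] lists the eigenvalues of X
   with multiplicity. Restricting to the nonzero ones matters at alpha = 0,
   since 0 `^ 0 = 1. *)
Definition trace_abs_power (d : nat) (X : 'M[R[i]]_d) (alpha : R) : R :=
  \sum_(i | spectral_diag X 0 i != 0)
    complex.Re `|spectral_diag X 0 i| `^ alpha.

(* tr (X^alpha) for X positive semidefinite. *)
Definition trace_power (d : nat) (X : 'M[R[i]]_d) (alpha : R) : R :=
  \sum_(i | spectral_diag X 0 i != 0)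
    complex.Re (spectral_diag X 0 i) `^ alpha.

Definition pt_negativity (n : nat) (A : {set 'I_n}) (rho : operator R 'I_n) :
  R := ln (trace_norm (partial_transpose A rho)).

Definition pt_moment (n : nat) (A : {set 'I_n}) (alpha : R)
    (rho : operator R 'I_n) : R :=
  trace_abs_power (partial_transpose A rho) alpha.

Definition purity (d : nat) (rho : 'M[R[i]]_d) : R :=
  complex.Re (\tr (rho *m rho)).

Definition p_negativity (n : nat) (A : {set 'I_n}) (alpha : R)
    (rho : operator R 'I_n) : R :=
  1 / (2 - alpha) * ln (pt_moment A alpha rho)
  + (1 - alpha) / (2 - alpha) * ln (purity rho).

(* At alpha = 1, the limit alpha -> 1 is the von Neumann entropy. *)
Definition renyi_entropy (n : nat) (A : {set 'I_n}) (alpha : R)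
    (psi : 'cV[R[i]]_(hdim 'I_n)) : R :=
  let rhoA := partial_trace A (ketbra psi) in
  if alpha == 1 then
    - \sum_(i | spectral_diag rhoA 0 i != 0)
        (complex.Re (spectral_diag rhoA 0 i)
         * ln (complex.Re (spectral_diag rhoA 0 i)))
  else 1 / (1 - alpha) * ln (trace_power rhoA alpha).

End Operators.

(* Main.v *)
Require Import Defs.
From HB Require Import structures.
From mathcomp Require Import all_boot all_order all_algebra.
From mathcomp Require Import spectral complex reals exp.
From mathcomp Require Import sesquilinear sequences ring lra.

Set Implicit Arguments.
Unset Strict Implicit.
Unset Printing Implicit Defensive.

Import Order.TTheory GRing.Theory Num.Theory.

(** Let l_i be the nonzero eigenvalues of rho^Gamma and f(s) = ln sum_i |l_i|^s.
    Since tr((rho^Gamma)^2) = tr(rho^2), f(2) = ln p_2, and E_alpha is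
    f(2) - (f(alpha) - f(2)) / (alpha - 2); the chord slopes of the convex
    function f from the point 2 are nondecreasing, so E_alpha decreases.
    Convexity is used in the form of supporting lines.

    A separable rho has positive semidefinite rho^Gamma, hence negativity
    ln tr(rho^Gamma) = 0.

    For a pure state with coefficient matrix Psi (rows A, columns B),
    (rho^Gamma)^2 = (Psi Psi^* ) (x) (Psi^* Psi), so the traces of its powers are
    the power sums of the products mu_i mu_j, where mu is the spectrum of
    rho_A = Psi Psi^*. Power sums determine sum_i g(l_i^2) for every g with
    g(0) = 0 by interpolation, whence sum |l_i|^alpha = (sum mu_i^(alpha/2))^2.
    The same principle identifies the trace norm with sum |l_i|. *)

Local Open Scope ring_scope.
Local Open Scope sesquilinear_scope.
Local Open Scope complex_scope.

(** * Interpolation and power sums *)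

Lemma poly_interpolation (F : fieldType) (g : F -> F) (s : seq F) :
  exists p : {poly F}, {in s, forall x, p.[x] = g x}.
Proof.
elim: s => [|a s [p ps]]; first by exists 0.
have [sa|nsa] := boolP (a \in s).
  by exists p => x; rewrite inE => /orP[/eqP ->|]; exact: ps.
(* Newton's correction: [q] vanishes on the earlier nodes and not at [a], so a multiple of it
   repairs the value at [a] alone. *)
pose q := \prod_(y <- s) ('X - y%:P).
have qa : q.[a] != 0 by rewrite -[_ == 0]/(root q a) root_prod_XsubC.
exists (p + ((g a - p.[a]) / q.[a])%:P * q) => x; rewrite inE !hornerE.
case/orP => [/eqP ->|xs]; first by rewrite divfK // addrC subrK.
have /eqP -> : q.[x] == 0 by rewrite -[_ == 0]/(root q x) root_prod_XsubC.
by rewrite mulr0 addr0 ps.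
Qed.

(* Interpolation replaces g by a polynomial without constant term. *)
Lemma eq_sum_of_eq_power_sums (F : fieldType) (I J : finType)
    (a : I -> F) (b : J -> F) (g : F -> F) :
  (forall k, \sum_i a i ^+ k.+1 = \sum_j b j ^+ k.+1) -> g 0 = 0 ->
  \sum_i g (a i) = \sum_j g (b j).
Proof.
move=> eq_ab g0.
(* The node 0 forces the constant coefficient of [p] to be [g 0 = 0]. The zeroth power sums, which
   are the cardinalities of [I] and [J] and may differ, thus drop out. *)
have [p p_g] := poly_interpolation g (0 :: codom a ++ codom b).
have sum_p (K : finType) (c : K -> F) : {in K, forall i, p.[c i] = g (c i)} ->
    \sum_i g (c i) = \sum_(k < size p) p`_k * \sum_i c i ^+ k.
  move=> p_c; under [RHS]eq_bigr do rewrite mulr_sumr.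
  by rewrite exchange_big; apply: eq_bigr => i _; rewrite -p_c // horner_coef.
rewrite !sum_p => [|j _|i _]; last 2 first.
- by apply: p_g; rewrite inE mem_cat codom_f !orbT.
- by apply: p_g; rewrite inE mem_cat codom_f orbT.
apply: eq_bigr => -[[|k] lt_k] _ /=; last by rewrite eq_ab.
by rewrite -horner_coef0 p_g ?mem_head // g0 !mul0r.
Qed.

(** * Convexity: supporting lines and chord slopes *)

Section LogSumExp.
Variables (R : realType) (I : finType) (P : pred I) (c : I -> R).
Hypothesis c_gt0 : forall i, P i -> 0 < c i.
Hypothesis P_neq0 : exists i, P i.

Lemma sum_powR_gt0 (s : R) : 0 < \sum_(i | P i) c i `^ s.
Proof.
have [i Pi] := P_neq0; rewrite (bigD1 i) //= ltr_wpDr ?powR_gt0 ?c_gt0 //.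
by apply: sumr_ge0 => j _; exact: powR_ge0.
Qed.

(* D is the derivative of the left-hand side at m, that is the mean of ln c
   for the weights proportional to c ^ m. *)
Lemma ln_sum_powR_support (m : R) : exists D, forall s,
  ln (\sum_(i | P i) c i `^ m) + D * (s - m) <= ln (\sum_(i | P i) c i `^ s).
Proof.
set Z := \sum_(i | P i) c i `^ m; have Z_gt0 : 0 < Z by exact: sum_powR_gt0.
pose D := (\sum_(i | P i) c i `^ m * ln (c i)) / Z.
exists D => s; rewrite -ler_expR expRD !lnK ?posrE ?sum_powR_gt0 //.
(* The first-order terms cancel because [D] is the weighted mean of [ln (c i)]. What remains is
   [1 + x <= expR x] term by term. *)
have -> : Z = \sum_(i | P i) c i `^ m * (1 + (s - m) * (ln (c i) - D)).
  have -> : \sum_(i | P i) c i `^ m * (1 + (s - m) * (ln (c i) - D)) =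
      Z + (s - m) * (\sum_(i | P i) c i `^ m * ln (c i) - Z * D).
    rewrite mulrBr mulr_sumr /Z mulr_suml mulr_sumr -sumrB -big_split /=.
    by apply: eq_bigr => i _; ring.
  by rewrite /D [Z * _]mulrC divfK ?gt_eqF // subrr mulr0 addr0.
rewrite mulr_suml; apply: ler_sum => i Pi.
have -> : c i `^ s =
    c i `^ m * expR ((s - m) * (ln (c i) - D)) * expR (D * (s - m)).
  by rewrite /powR gt_eqF ?c_gt0 // -!expRD; congr expR; ring.
rewrite ler_pM2r ?expR_gt0 // ler_pM2l ?powR_gt0 ?c_gt0 //.
exact: expR_ge1Dx.
Qed.

End LogSumExp.

(** The supporting line at the middle one of [a], [b], [p] lies below [f] at the other two points,
    which compares the two chords. The denominators [p - a] and [p - b] make both sides negated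
    slopes; they have opposite signs exactly when [p] is in the middle, the case for [crossN]. *)
Lemma chord_slope_le (R : realFieldType) (f : R -> R) (p a b : R) :
  (forall m, exists D, forall s, f m + D * (s - m) <= f s) ->
  a < b -> a != p -> b != p -> (f b - f p) / (p - b) <= (f a - f p) / (p - a).
Proof.
move=> supp lt_ab a_p b_p.
have cross (x y u v : R) : 0 < u * v -> x * v <= y * u -> x / u <= y / v.
  move=> uv le_xy; have /andP[u0 v0] : (u != 0) && (v != 0).
    by rewrite -negb_or -mulf_eq0 gt_eqF.
  rewrite -subr_le0 (_ : _ - _ = (x * v - y * u) / (u * v)).
    by rewrite pmulr_lle0 ?invr_gt0 // subr_le0.
  by field; rewrite ?u0 ?v0.
have crossN (x y u v : R) : u * v < 0 -> y * u <= x * v -> x / u <= y / v.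
  move=> uv le_xy; rewrite -[x / u]mulrNN -invrN; apply: cross;
    by rewrite ?mulNr ?mulrN ?oppr_gt0 ?lerN2.
have [D2 s2] := supp p; have [Da sa] := supp a; have [Db sb] := supp b.
case: (ltgtP b p) b_p => // [b_p|p_b] _.
  have := sb a; have := sb p => h1 h2; apply: cross; first by nra.
  nra.
case: (ltgtP a p) a_p => // [a_p|p_a] _.
  have := s2 a; have := s2 b => h1 h2; apply: crossN; first by nra.
  nra.
have := sa p; have := sa b => h1 h2; apply: cross; first by nra.
nra.
Qed.

(** * Spectra, traces of powers and positivity *)

Section Spectral.
Variable C : numClosedFieldType.

Lemma ctrmxK m n (X : 'M[C]_(m, n)) : X ^t* ^t* = X.
Proof. by apply/matrixP => i j; rewrite !mxE conjCK. Qed.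

Lemma ctrmx_mul m n p (X : 'M[C]_(m, n)) (Y : 'M[C]_(n, p)) :
  (X *m Y) ^t* = Y ^t* *m X ^t*.
Proof. by rewrite trmx_mul map_mxM. Qed.

Lemma hermsymmxP d (X : 'M[C]_d) : reflect (X ^t* = X) (X \is hermsymmx).
Proof. by rewrite is_hermitianmxE expr0 scale1r eq_sym; exact: eqP. Qed.

Lemma mulmx_ctrmx_herm m n (X : 'M[C]_(m, n)) : X *m X ^t* \is hermsymmx.
Proof. by apply/hermsymmxP; rewrite ctrmx_mul ctrmxK. Qed.

Lemma normal_spectralE d (X : 'M[C]_d) : X \is normalmx ->
  X = (spectralmx X) ^t* *m diag_mx (spectral_diag X) *m spectralmx X.
Proof.
by move/orthomx_spectralP => {1}->; rewrite invmx_unitary ?spectral_unitarymx.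
Qed.

Lemma mxtrace_exp_spectral d (X : 'M[C]_d) k : X \is normalmx ->
  \tr (X ^+ k) = \sum_i spectral_diag X 0 i ^+ k.
Proof.
move=> /normal_spectralE XE; set P := spectralmx X in XE.
have PPt : P *m P ^t* = 1%:M by apply/unitarymxP/spectral_unitarymx.
have PtP : P ^t* *m P = 1%:M by exact: mulmx1C.
set D := spectral_diag X in XE *.
have -> : X ^+ k = P ^t* *m diag_mx (\row_i D 0 i ^+ k) *m P.
  elim: k => [|k IHk].
    rewrite (_ : \row_i _ = const_mx 1).
      by rewrite diag_const_mx mulmx1 PtP.
    by apply/rowP => i; rewrite !mxE.
  rewrite exprS IHk {1}XE -mulmxE !mulmxA -[_ *m P *m P ^t*]mulmxA PPt mulmx1.
  rewrite -[P ^t* *m diag_mx D *m _]mulmxA mulmx_diag.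
  by congr (_ *m diag_mx _ *m _); apply/rowP => i; rewrite !mxE exprS.
rewrite mxtrace_mulC mulmxA PPt mul1mx mxtrace_diag.
by apply: eq_bigr => i _; rewrite mxE.
Qed.

(** Spectral sums are read off from traces of powers, so two eigenvalue lists never have to be
    matched entry by entry. *)
Lemma sum_spectral_diag d (J : finType) (X : 'M[C]_d) (b : J -> C)
    (g : C -> C) : X \is normalmx ->
  (forall k, \tr (X ^+ k.+1) = \sum_j b j ^+ k.+1) -> g 0 = 0 ->
  \sum_i g (spectral_diag X 0 i) = \sum_j g (b j).
Proof.
move=> Xn tr_b; apply: eq_sum_of_eq_power_sums => k.
by rewrite -tr_b mxtrace_exp_spectral.
Qed.

Definition psdmx d (X : 'M[C]_d) :=
  forall v : 'cV[C]_d, 0 <= (v ^t* *m X *m v) 0 0.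

(** The quadratic form at the [i]-th eigenvector, the column P^* e_i, is the [i]-th eigenvalue. *)
Lemma spectral_diag_ge0 d (X : 'M[C]_d) i : X \is normalmx -> psdmx X ->
  0 <= spectral_diag X 0 i.
Proof.
move=> /normal_spectralE XE /(_ ((spectralmx X) ^t* *m delta_mx i 0)).
set P := spectralmx X in XE *; set D := spectral_diag X in XE *.
have PPt : P *m P ^t* = 1%:M by apply/unitarymxP/spectral_unitarymx.
rewrite ctrmx_mul ctrmxK {1}XE !mulmxA.
rewrite -[_ *m P *m P ^t*]mulmxA PPt mulmx1.
rewrite -[_ *m P *m P ^t*]mulmxA PPt mulmx1.
rewrite (_ : (delta_mx i 0) ^t* = delta_mx 0 i); last first.
  by rewrite trmx_delta map_delta_mx.
by rewrite -rowE -colE !mxE eqxx mulr1n.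
Qed.

(** Take M = sqrt(D) P in the diagonalisation X = P^* D P. Gram factors reduce positivity of a
    tensor product to that of a single Gram matrix. *)
Lemma psdmx_gram d (X : 'M[C]_d) : X \is normalmx -> psdmx X ->
  exists M : 'M[C]_d, X = M ^t* *m M.
Proof.
move=> Xn Xpsd; have XE := normal_spectralE Xn.
set P := spectralmx X in XE; set D := spectral_diag X in XE.
pose S := \row_i sqrtC (D 0 i).
have S_real : (diag_mx S) ^t* = diag_mx S.
  rewrite tr_diag_mx map_diag_mx; congr diag_mx; apply/rowP => i.
  by rewrite !mxE; apply: geC0_conj; rewrite sqrtC_ge0; exact: spectral_diag_ge0.
exists (diag_mx S *m P); rewrite ctrmx_mul S_real XE !mulmxA.
rewrite -[P ^t* *m diag_mx S *m _]mulmxA mulmx_diag.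
by congr (_ *m diag_mx _ *m _); apply/rowP => i; rewrite !mxE -expr2 sqrtCK.
Qed.

Lemma psdmx_ctrmx_mul m d (X : 'M[C]_(m, d)) : psdmx (X ^t* *m X).
Proof.
move=> v; rewrite -!mulmxA mulmxA -ctrmx_mul mxE.
by apply: sumr_ge0 => i _; rewrite !mxE mulrC mul_conjC_ge0.
Qed.

Lemma psdmx_sum d m (c : 'I_m -> C) (X : 'I_m -> 'M[C]_d) :
  (forall k, 0 <= c k) -> (forall k, psdmx (X k)) ->
  psdmx (\sum_k c k *: X k).
Proof.
move=> c_ge0 Xpsd v; rewrite mulmx_sumr mulmx_suml summxE.
apply: sumr_ge0 => k _; rewrite -scalemxAr -scalemxAl mxE.
exact: mulr_ge0 (c_ge0 k) (Xpsd k v).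
Qed.

End Spectral.

(** * Tensor products and partial transposition on qubits *)

Section QubitOperators.
Variable R : realType.
Local Notation C := R[i].

Section Entries.
Variable I : finType.
Implicit Types X Y : operator R I.

Lemma big_hdim (V : nmodType) (F : 'I_(hdim I) -> V) :
  \sum_i F i = \sum_(x : bits I) F (enum_rank x).
Proof. by rewrite (reindex enum_rank) //; exact/onW_bij/enum_rank_bij. Qed.

Lemma operator_ext X Y : (forall x y, entry X x y = entry Y x y) -> X = Y.
Proof.
move=> XY; apply/matrixP => i j.
by have := XY (enum_val i) (enum_val j); rewrite /entry !enum_valK.
Qed.

Lemma entry_operator_of (f : bits I -> bits I -> C) x y :
  entry (operator_of f) x y = f x y.
Proof. by rewrite /entry mxE !enum_rankK. Qed.

Lemma entry_mul X Y x z :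
  entry (X *m Y) x z = \sum_y entry X x y * entry Y y z.
Proof. by rewrite /entry mxE big_hdim. Qed.

Lemma mxtrace_entry X : \tr X = \sum_x entry X x x.
Proof. by rewrite /mxtrace big_hdim. Qed.

Lemma entry_conj X x y : entry (X ^t*) x y = (entry X y x)^*.
Proof. by rewrite /entry !mxE. Qed.

End Entries.

Variables (n : nat) (A : {set 'I_n}).
Local Notation resA := (restrict_bits A).
Local Notation resB := (restrict_bits (~: A)).
Local Notation mix := (mix_bits A).

Lemma restrict_mixA x y : resA (mix x y) = resA x.
Proof. by apply/ffunP => -[k kA]; rewrite !ffunE /= kA. Qed.

Lemma restrict_mixB x y : resB (mix x y) = resB y.
Proof.
apply/ffunP => -[k kB]; rewrite !ffunE /=.
by move: kB; rewrite inE => /negbTE ->.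
Qed.

Lemma mix_mix x y : mix (mix x y) (mix y x) = x.
Proof. by apply/ffunP => k; rewrite !ffunE; case: (k \in A). Qed.

Lemma mix_id x : mix x x = x.
Proof. by apply/ffunP => k; rewrite !ffunE; case: (k \in A). Qed.

(** The splitting of the Hilbert space into A and B factors, at the level of basis labels: an
    injection between sets of equal size 2^n = 2^|A| 2^|B|. *)
Lemma restrict_pair_bij : bijective (fun x => (resA x, resB x)).
Proof.
apply: inj_card_bij => [x y [eqA eqB]|].
  apply/ffunP => k; have [kA|kA] := boolP (k \in A).
    by have /ffunP /(_ (exist _ k kA)) := eqA; rewrite !ffunE.
  have kB : k \in ~: A by rewrite inE.
  by have /ffunP /(_ (exist _ k kB)) := eqB; rewrite !ffunE.
rewrite card_prod !card_ffun !card_bool -expnD !card_sig.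
by rewrite -[X in (_ <= _ ^ X)%N](cardsC A).
Qed.

Lemma big_restrict (V : nmodType)
    (F : bits (qubits A) -> bits (qubits (~: A)) -> V) :
  \sum_x F (resA x) (resB x) = \sum_a \sum_b F a b.
Proof.
rewrite pair_big /= (reindex (fun x => (resA x, resB x))) //.
exact/onW_bij/restrict_pair_bij.
Qed.

Lemma tensor_mul (X X' : operator R (qubits A))
    (Y Y' : operator R (qubits (~: A))) :
  tensor X Y *m tensor X' Y' = tensor (X *m X') (Y *m Y').
Proof.
apply: operator_ext => x z; rewrite entry_mul entry_operator_of !entry_mul.
rewrite (eq_bigr (fun y => (entry X (resA x) (resA y) * entry X' (resA y) (resA z))
   * (entry Y (resB x) (resB y) * entry Y' (resB y) (resB z)))); last first.
  by move=> y _; rewrite !entry_operator_of mulrACA.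
rewrite (big_restrict (fun a b => (entry X _ a * entry X' a _)
   * (entry Y _ b * entry Y' b _))).
by rewrite mulr_suml; apply: eq_bigr => a _; rewrite mulr_sumr.
Qed.

Lemma tensor_conj (X : operator R (qubits A))
    (Y : operator R (qubits (~: A))) :
  (tensor X Y) ^t* = tensor (X ^t*) (Y ^t*).
Proof.
apply: operator_ext => x y.
by rewrite entry_conj !entry_operator_of !entry_conj rmorphM.
Qed.

Lemma mxtrace_tensor (X : operator R (qubits A))
    (Y : operator R (qubits (~: A))) : \tr (tensor X Y) = \tr X * \tr Y.
Proof.
rewrite !mxtrace_entry; under eq_bigr do rewrite entry_operator_of.
rewrite (big_restrict (fun a b => entry X a a * entry Y b b)).
by rewrite mulr_suml; apply: eq_bigr => a _; rewrite mulr_sumr.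
Qed.

Lemma tensor_exp (X : operator R (qubits A))
    (Y : operator R (qubits (~: A))) k :
  tensor X Y ^+ k.+1 = tensor (X ^+ k.+1) (Y ^+ k.+1).
Proof.
elim: k => [|k IHk]; first by rewrite !expr1.
by rewrite exprS IHk -mulmxE tensor_mul !mulmxE -!exprS.
Qed.

Lemma psdmx_tensor (X : operator R (qubits A))
    (Y : operator R (qubits (~: A))) :
  X \is hermsymmx -> Y \is hermsymmx -> psdmx X -> psdmx Y ->
  psdmx (tensor X Y^T).
Proof.
move=> /hermitian_normalmx Xn /hermitian_normalmx Yn.
move=> /(psdmx_gram Xn)[M ->] /(psdmx_gram Yn)[N ->].
(* [N ^t* ^T] is the entrywise conjugate of [N], so the transpose of a Gram matrix is again a Gram
   matrix. *)
have -> : (N ^t* *m N)^T = (N ^t* ^T) ^t* *m N ^t* ^T.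
  by rewrite trmx_mul; congr (_ *m _); apply/matrixP => i j; rewrite !mxE conjCK.
rewrite -tensor_mul -tensor_conj; exact: psdmx_ctrmx_mul.
Qed.

Lemma partial_transpose_sum m (c : 'I_m -> C) (X : 'I_m -> operator R 'I_n) :
  partial_transpose A (\sum_k c k *: X k) =
  \sum_k c k *: partial_transpose A (X k).
Proof.
apply/matrixP => i j; rewrite mxE /entry !summxE.
by apply: eq_bigr => k _; rewrite !mxE.
Qed.

Lemma partial_transpose_herm (X : operator R 'I_n) :
  X \is hermsymmx -> partial_transpose A X \is hermsymmx.
Proof.
move/hermsymmxP => XE; apply/hermsymmxP; apply: operator_ext => x y.
by rewrite entry_conj !entry_operator_of -entry_conj XE.
Qed.

Lemma mxtrace_partial_transpose (X : operator R 'I_n) :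
  \tr (partial_transpose A X) = \tr X.
Proof.
rewrite !mxtrace_entry; apply: eq_bigr => x _.
by rewrite entry_operator_of mix_id.
Qed.

(** Both traces are sums over pairs of basis labels. Partial transposition swaps the B parts of a
    pair, which is an involution, so it only reindexes the sum. *)
Lemma mxtrace_partial_transpose_sqr (X : operator R 'I_n) :
  \tr (partial_transpose A X *m partial_transpose A X) = \tr (X *m X).
Proof.
rewrite !mxtrace_entry; under eq_bigr do rewrite entry_mul.
under [RHS]eq_bigr do rewrite entry_mul.
rewrite !pair_big /=.
rewrite [RHS](reindex (fun p => (mix p.1 p.2, mix p.2 p.1))) /=.
  by apply: eq_bigr => -[x y] _; rewrite !entry_operator_of.
apply: onW_bij; exists (fun p => (mix p.1 p.2, mix p.2 p.1)) => -[x y] /=;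
  by rewrite !mix_mix.
Qed.

(** The Peres criterion: each product term becomes X (x) Y^T, and transposing a single factor
    preserves positivity. *)
Lemma separable_partial_transpose_psd (rho : operator R 'I_n) :
  separable A rho -> psdmx (partial_transpose A rho).
Proof.
case=> m [p [sA [sB [p_ge0 _ sA_state sB_state ->]]]].
rewrite partial_transpose_sum; apply: psdmx_sum => k; first by rewrite ler0c.
rewrite partial_transpose_tensor.
by have [? ? _] := sA_state k; have [? ? _] := sB_state k; exact: psdmx_tensor.
Qed.

End QubitOperators.

(** * Moments as spectral sums *)

Section Moments.
Variable R : realType.
Local Notation C := R[i].

Lemma Re_norm_gt0 (z : C) : z != 0 -> 0 < complex.Re `|z|.
Proof. by rewrite -normr_gt0 ltcE => /andP[]. Qed.

Lemma herm_spectral_diag_real d (X : 'M[C]_d) i : X \is hermsymmx ->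
  exists r : R, spectral_diag X 0 i = r%:C.
Proof.
move=> /hermitian_spectral_diag_real /mxOverP /(_ 0 i).
by move/complex_realP.
Qed.

Lemma Re_norm_real (r : R) : complex.Re `|r%:C| = `|r|.
Proof. by rewrite normc_def /= expr0n addr0 sqrtr_sqr. Qed.

Lemma trace_abs_power1 d (X : 'M[C]_d) :
  trace_abs_power X 1 = \sum_i complex.Re `|spectral_diag X 0 i|.
Proof.
rewrite /trace_abs_power big_mkcond; apply: eq_bigr => i _.
have [->|/Re_norm_gt0 /ltW] := eqVneq (spectral_diag X 0 i) 0.
  by rewrite normr0.
exact: powRr1.
Qed.

Lemma mxtrace_sqr_exp d (X : 'M[C]_d) k : X \is hermsymmx ->
  \tr ((X *m X) ^+ k) = \sum_i (spectral_diag X 0 i ^+ 2) ^+ k.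
Proof.
move=> /hermitian_normalmx Xn; rewrite mulmxE -expr2 -exprM.
by rewrite mxtrace_exp_spectral //; apply: eq_bigr => i _; rewrite exprM.
Qed.

(** The traces of powers of X^* X = X^2 are the power sums of the squared eigenvalues of [X], and
    the square root of such a square is the absolute value. *)
Lemma trace_norm_herm d (X : 'M[C]_d) : X \is hermsymmx ->
  trace_norm X = trace_abs_power X 1.
Proof.
move=> Xh; rewrite trace_abs_power1; apply: complexI; rewrite !rmorph_sum.
have /hermitian_normalmx Gn := mulmx_ctrmx_herm (X ^t*).
rewrite ctrmxK in Gn.
rewrite (sum_spectral_diag (b := fun i => spectral_diag X 0 i ^+ 2)
           (g := fun z => (Num.sqrt (complex.Re z))%:C)) //.
- apply: eq_bigr => i _; have [r ->] := herm_spectral_diag_real i Xh.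
  by rewrite Re_norm_real -rmorphXn sqrtr_sqr.
- by move=> k; rewrite (hermsymmxP _ Xh) mxtrace_sqr_exp.
- by rewrite /= sqrtr0.
Qed.

Lemma trace_abs_power2 d (X : 'M[C]_d) : X \is hermsymmx ->
  trace_abs_power X 2 = purity X.
Proof.
move=> Xh; rewrite /purity; have := mxtrace_sqr_exp 1 Xh; rewrite expr1 => ->.
apply: complexI.
rewrite (_ : (complex.Re _)%:C = \sum_i spectral_diag X 0 i ^+ 2); last first.
  rewrite RRe_real //; apply: rpred_sum => i _.
  have [r ->] := herm_spectral_diag_real i Xh.
  by rewrite -rmorphXn complex_real.
rewrite rmorph_sum big_mkcond; apply: eq_bigr => i _.
have [r ->] := herm_spectral_diag_real i Xh.
have [->|_] := eqVneq r%:C 0; first by rewrite expr0n.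
by rewrite Re_norm_real powR_mulrn ?normr_ge0 // real_normK ?num_real ?rmorphXn.
Qed.

(** The value at 0 is 0 even for [s = 0], where the real power would give 1. This encodes the
    restriction to nonzero eigenvalues and meets the condition [g 0 = 0] of the power-sum
    principle. *)
Definition powC (s : R) (z : C) : C :=
  if z == 0 then 0 else (complex.Re z `^ s)%:C.

Lemma powC0 s : powC s 0 = 0. Proof. by rewrite /powC eqxx. Qed.

Lemma powCM s (x y : C) : 0 <= x -> 0 <= y ->
  powC s (x * y) = powC s x * powC s y.
Proof.
move=> x0 y0; rewrite /powC mulf_eq0.
have [_|_] := eqVneq x 0; first by rewrite mul0r.
have [_|_] := eqVneq y 0; first by rewrite mulr0.
rewrite /= -rmorphM -powRM; last 2 first.
- by move: x0; rewrite lecE => /andP[].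
- by move: y0; rewrite lecE => /andP[].
congr (_ `^ _)%:C; rewrite -[x]RRe_real ?ger0_real // -[y]RRe_real ?ger0_real //.
by rewrite -rmorphM.
Qed.

(** The moment is expressed through squared eigenvalues because, for a pure state, it is the square
    of the partial transpose that factorises. *)
Lemma trace_abs_powerE d (X : 'M[C]_d) (alpha : R) : X \is hermsymmx ->
  (trace_abs_power X alpha)%:C =
  \sum_i powC (alpha / 2) (spectral_diag X 0 i ^+ 2).
Proof.
move=> Xh; rewrite rmorph_sum big_mkcond; apply: eq_bigr => i _.
have [r ->] := herm_spectral_diag_real i Xh.
have [->|r_neq0] := eqVneq r%:C 0; first by rewrite expr0n powC0.
rewrite /powC sqrf_eq0 (negbTE r_neq0).
rewrite Re_norm_real -rmorphXn -real_normK ?num_real //.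
rewrite -powR_mulrn ?normr_ge0 //=.
by rewrite -powRrM [2 * _]mulrC divfK ?pnatr_eq0.
Qed.

Lemma trace_powerE d (X : 'M[C]_d) (s : R) :
  (trace_power X s)%:C = \sum_i powC s (spectral_diag X 0 i).
Proof.
rewrite rmorph_sum big_mkcond; apply: eq_bigr => i _.
by rewrite /powC; case: eqVneq.
Qed.

End Moments.

(** * Pure states and their coefficient matrix *)

Section PureState.
Variables (R : realType) (n : nat) (A : {set 'I_n}).
Local Notation C := R[i].
Local Notation resA := (restrict_bits A).
Local Notation resB := (restrict_bits (~: A)).

(** The two products may differ in size, so the traces agree for positive exponents only; this
    serves Psi Psi^* against Psi^* Psi. *)
Lemma mxtrace_exp_mulC m d (X : 'M[C]_(m, d)) (Y : 'M[C]_(d, m)) k :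
  \tr ((X *m Y) ^+ k.+1) = \tr ((Y *m X) ^+ k.+1).
Proof.
have comm j : (X *m Y) ^+ j *m X = X *m (Y *m X) ^+ j.
  elim: j => [|j IHj]; first by rewrite !expr0 mul1mx mulmx1.
  by rewrite !exprS -!mulmxE -mulmxA IHj !mulmxA.
by rewrite exprSr -mulmxE mulmxA comm mxtrace_mulC mulmxA mulmxE -exprS.
Qed.

Lemma bipartite_coefficients (psi : 'cV[C]_(hdim 'I_n)) :
  exists Psi : 'M[C]_(hdim (qubits A), hdim (qubits (~: A))), forall x,
    psi (enum_rank x) 0 = Psi (enum_rank (resA x)) (enum_rank (resB x)).
Proof.
have [join joinK _] := restrict_pair_bij A.
exists (\matrix_(i, j) psi (enum_rank (join (enum_val i, enum_val j))) 0) => x.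
by rewrite mxE !enum_rankK joinK.
Qed.

Variables (psi : 'cV[C]_(hdim 'I_n)).
Variable Psi : 'M[C]_(hdim (qubits A), hdim (qubits (~: A))).
Hypothesis PsiE : forall x,
  psi (enum_rank x) 0 = Psi (enum_rank (resA x)) (enum_rank (resB x)).

Lemma entry_ketbra x y : entry (ketbra psi) x y =
  Psi (enum_rank (resA x)) (enum_rank (resB x))
  * (Psi (enum_rank (resA y)) (enum_rank (resB y)))^*.
Proof. by rewrite /entry mxE big_ord1 !mxE !PsiE. Qed.

Lemma partial_trace_ketbra : partial_trace A (ketbra psi) = Psi *m Psi ^t*.
Proof.
apply: operator_ext => a a'; rewrite entry_operator_of /entry mxE big_hdim.
pose K (a1 : bits (qubits A)) (b1 : bits (qubits (~: A))) :=
  Psi (enum_rank a1) (enum_rank b1).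
(* Both bit strings are split into A and B parts. The constraints become Kronecker deltas, and only
   the sum over the common B part survives. *)
rewrite (eq_bigr (fun x => \sum_a2 \sum_b2
  if [&& resA x == a, a2 == a' & resB x == b2] then
    K (resA x) (resB x) * (K a2 b2)^* else 0)); last first.
  move=> x _; rewrite big_mkcond /=.
  rewrite -(big_restrict (fun a2 b2 => if [&& resA x == a, a2 == a' & resB x == b2]
    then K (resA x) (resB x) * (K a2 b2)^* else 0)).
  by apply: eq_bigr => y _; rewrite -/(entry _ x y) entry_ketbra.
rewrite (big_restrict (fun a1 b1 => \sum_a2 \sum_b2
  if [&& a1 == a, a2 == a' & b1 == b2] then K a1 b1 * (K a2 b2)^* else 0)).
rewrite (bigD1 a) //= [X in _ + X]big1 ?addr0 => [|a1 /negbTE ->]; last first.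
  by rewrite big1 // => b1 _; rewrite big1 // => a2 _; rewrite big1.
apply: eq_bigr => b _; rewrite eqxx /=.
rewrite (bigD1 a') //= [X in _ + X]big1 ?addr0 => [|a1 /negbTE ->]; last first.
  by rewrite big1.
rewrite eqxx /= (bigD1 b) //= eqxx big1 ?addr0 => [|b1]; last first.
  by rewrite eq_sym => /negbTE ->.
by rewrite !mxE.
Qed.

(** The entry at (x, y) of the partial transpose is Psi(x_A, y_B) times the conjugate of Psi(y_A,
    x_B). In the product, the intermediate label y therefore separates: y_B sums to an entry of Psi
    Psi^*, and y_A to one of Psi^* Psi. *)
Lemma partial_transpose_ketbra_sqr :
  partial_transpose A (ketbra psi) *m partial_transpose A (ketbra psi) =
  tensor (Psi *m Psi ^t*) (Psi ^t* *m Psi).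
Proof.
apply: operator_ext => x z; rewrite entry_mul entry_operator_of.
pose K (a : bits (qubits A)) (b : bits (qubits (~: A))) :=
  Psi (enum_rank a) (enum_rank b).
rewrite (eq_bigr (fun y =>
  (K (resA x) (resB y) * (K (resA z) (resB y))^*)
  * ((K (resA y) (resB x))^* * K (resA y) (resB z)))); last first.
  move=> y _; rewrite !entry_operator_of !entry_ketbra.
  by rewrite !restrict_mixA !restrict_mixB /K; ring.
rewrite (big_restrict (fun a b => (K _ b * (K _ b)^*) * ((K a _)^* * K a _))).
rewrite exchange_big /entry !mxE !big_hdim mulr_suml.
apply: eq_bigr => b _; rewrite mulr_sumr; apply: eq_bigr => a _.
by rewrite !mxE.
Qed.

Lemma trace_abs_power_ketbra alpha :
  trace_abs_power (partial_transpose A (ketbra psi)) alpha =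
  trace_power (partial_trace A (ketbra psi)) (alpha / 2) ^+ 2.
Proof.
have Gh : partial_transpose A (ketbra psi) \is hermsymmx.
  by apply: partial_transpose_herm; exact: mulmx_ctrmx_herm.
have Tn := hermitian_normalmx (mulmx_ctrmx_herm Psi).
have Tpsd : psdmx (Psi *m Psi ^t*).
  by rewrite -{1}[Psi]ctrmxK; exact: psdmx_ctrmx_mul.
rewrite partial_trace_ketbra; apply: complexI; rewrite expr2 rmorphM /=.
rewrite trace_abs_powerE // trace_powerE; set mu := spectral_diag (Psi *m _).
(* The squared eigenvalues of the partial transpose are compared with the products mu_i mu_j.
   Multiplicativity of [powC] on nonnegative numbers then splits the double sum into a square. *)
rewrite (eq_sum_of_eq_power_sums (b := fun p => mu 0 p.1 * mu 0 p.2));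
  last exact: powC0.
- rewrite mulr_suml; under [RHS]eq_bigr do rewrite mulr_sumr.
  rewrite pair_big; apply: eq_bigr => p _.
  by rewrite powCM //; exact: spectral_diag_ge0.
- move=> k; rewrite -mxtrace_sqr_exp // partial_transpose_ketbra_sqr tensor_exp.
  rewrite mxtrace_tensor [X in _ * X]mxtrace_exp_mulC !mxtrace_exp_spectral //.
  rewrite mulr_suml; under eq_bigr do rewrite mulr_sumr.
  by rewrite pair_big; apply: eq_bigr => p _; rewrite exprMn.
Qed.

End PureState.

(** * Monotonicity, separability and the pure-state formula *)

Section Negativity.
Variables (R : realType) (n : nat) (A : {set 'I_n}).
Local Notation C := R[i].

Section States.
Variable rho : operator R 'I_n.
Hypothesis rho_state : is_state rho.
Let G := partial_transpose A rho.

Lemma state_partial_transpose_herm : G \is hermsymmx.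
Proof. by have [rho_herm _ _] := rho_state; exact: partial_transpose_herm. Qed.
Local Hint Resolve state_partial_transpose_herm : core.

Lemma sum_spectral_partial_transpose : \sum_i spectral_diag G 0 i = 1.
Proof.
have [_ _ <-] := rho_state; rewrite -(mxtrace_partial_transpose A).
rewrite -[in RHS](expr1 (partial_transpose A rho)).
by rewrite mxtrace_exp_spectral ?hermitian_normalmx.
Qed.

(** The eigenvalues sum to 1, so they cannot all vanish. This makes every moment positive, and its
    logarithm genuine. *)
Lemma spectral_partial_transpose_neq0 : exists i, spectral_diag G 0 i != 0.
Proof.
apply/existsP; apply: contraT; rewrite negb_exists => /forallP lam0.
have := sum_spectral_partial_transpose; rewrite big1 => [/eqP|i _].
  by rewrite eq_sym oner_eq0.
exact/eqP/negPn/lam0.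
Qed.

Lemma ln_pt_moment_support (m : R) : exists D, forall s,
  ln (pt_moment A m rho) + D * (s - m) <= ln (pt_moment A s rho).
Proof.
apply: ln_sum_powR_support => [i|]; first exact: Re_norm_gt0.
exact: spectral_partial_transpose_neq0.
Qed.

Lemma pt_moment2 : pt_moment A 2 rho = purity rho.
Proof.
by rewrite /pt_moment trace_abs_power2 // /purity mxtrace_partial_transpose_sqr.
Qed.

(** Since (1 - alpha)/(2 - alpha) = 1 - 1/(2 - alpha), the purity terms combine into the negated
    chord slope from 2, as in [chord_slope_le]. *)
Lemma p_negativityE alpha : alpha != 2 -> p_negativity A alpha rho =
  ln (pt_moment A 2 rho)
  + (ln (pt_moment A alpha rho) - ln (pt_moment A 2 rho)) / (2 - alpha).
Proof.
move=> alpha2; rewrite /p_negativity -pt_moment2; field.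
by rewrite subr_eq0 eq_sym.
Qed.

Lemma p_negativity_le alpha beta : alpha < beta -> alpha != 2 -> beta != 2 ->
  p_negativity A beta rho <= p_negativity A alpha rho.
Proof.
move=> lt_ab alpha2 beta2; rewrite !p_negativityE // lerD2l.
exact: (chord_slope_le ln_pt_moment_support).
Qed.

Lemma p_negativity1 : p_negativity A 1 rho = pt_negativity A rho.
Proof.
rewrite /p_negativity /pt_negativity trace_norm_herm // /pt_moment.
by rewrite subrr mul0r mul0r addr0 (_ : 2 - 1 = 1) ?divr1 ?mul1r //; ring.
Qed.

Lemma p_negativity_le_pt alpha : 1 <= alpha -> alpha != 2 ->
  p_negativity A alpha rho <= pt_negativity A rho.
Proof.
rewrite le_eqVlt => /predU1P[<- _|alpha1 alpha2]; first by rewrite p_negativity1.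
by rewrite -p_negativity1 p_negativity_le // lt_eqF // ltr1n.
Qed.

Lemma separable_pt_negativity : separable A rho -> pt_negativity A rho = 0.
Proof.
move=> /separable_partial_transpose_psd Gpsd.
rewrite /pt_negativity trace_norm_herm // trace_abs_power1.
rewrite (_ : \sum_i _ = 1) ?ln1 //; apply: complexI.
rewrite -[RHS]sum_spectral_partial_transpose rmorph_sum.
apply: eq_bigr => i _.
have lam_ge0 : 0 <= spectral_diag G 0 i.
  by apply: spectral_diag_ge0 => //; exact: hermitian_normalmx.
by rewrite ger0_norm //; exact/RRe_real/ger0_real.
Qed.

End States.

Lemma ketbra_state (psi : 'cV[C]_(hdim 'I_n)) :
  is_unit_vector psi -> is_state (ketbra psi).
Proof.
move=> psi1; split; first exact: mulmx_ctrmx_herm.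
  by rewrite /ketbra -{1}[psi]ctrmxK; exact: psdmx_ctrmx_mul.
by rewrite mxtrace_mulC psi1 mxtrace1.
Qed.

Lemma purity_ketbra (psi : 'cV[C]_(hdim 'I_n)) :
  is_unit_vector psi -> purity (ketbra psi) = 1.
Proof.
move=> psi1; rewrite /purity /ketbra mulmxA -[_ *m psi]mulmxA psi1 mulmx1.
by rewrite mxtrace_mulC psi1 mxtrace1.
Qed.

Lemma p_negativity_ketbra (psi : 'cV[C]_(hdim 'I_n)) (alpha : R) :
  is_unit_vector psi -> alpha != 2 ->
  p_negativity A alpha (ketbra psi) = renyi_entropy A (alpha / 2) psi.
Proof.
move=> psi1 alpha2; rewrite /p_negativity purity_ketbra // ln1 mulr0 addr0.
have [Psi PsiE] := bipartite_coefficients A psi.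
rewrite /pt_moment (trace_abs_power_ketbra PsiE) /renyi_entropy.
(* The excluded [alpha = 2] corresponds exactly to the von Neumann branch of [renyi_entropy]. *)
have alpha_half : alpha / 2 != 1.
  by apply: contra alpha2 => /eqP alphaE; apply/eqP; lra.
rewrite (negbTE alpha_half); set t := trace_power _ _.
have -> : ln (t ^+ 2) = 2 * ln t.
  (* The case [t = 0] is settled by the default value [ln 0 = 0]. *)
  have: 0 <= t by apply: sumr_ge0 => i _; exact: powR_ge0.
  rewrite le_eqVlt => /predU1P[<-|t_gt0].
    by rewrite expr0n /= ln0 // mulr0.
  by rewrite lnXn // mulr_natl.
by field; rewrite !subr_eq0 ![_ == alpha]eq_sym alpha2.
Qed.

End Negativity.

Local Close Scope complex_scope.
Local Close Scope sesquilinear_scope.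

Theorem mainTheorem8 (R : realType) (n : nat) (A : {set 'I_n}) :
  (forall rho : operator R 'I_n, is_state rho ->
     (forall alpha beta : R,
        0 <= alpha -> alpha < beta -> alpha != 2 -> beta != 2 ->
        p_negativity A beta rho <= p_negativity A alpha rho)
     /\ (forall alpha : R, 1 <= alpha -> alpha != 2 ->
           p_negativity A alpha rho <= pt_negativity A rho
           /\ (0 < p_negativity A alpha rho ->
                 0 < pt_negativity A rho /\ entangled A rho)))
  /\ (forall psi : 'cV[R[i]]_(hdim 'I_n), is_unit_vector psi ->
        forall alpha : R, 0 <= alpha -> alpha != 2 ->
          p_negativity A alpha (ketbra psi) = renyi_entropy A (alpha / 2) psi).
Proof.
split=> [rho rho_state|psi psi1 alpha _ alpha2]; last exact: p_negativity_ketbra.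
split=> [alpha beta _|alpha alpha1 alpha2]; first exact: p_negativity_le.
have le_alpha := p_negativity_le_pt A rho_state alpha1 alpha2.
split=> // /lt_le_trans /(_ le_alpha) pt_gt0; split=> // rho_sep.
by rewrite (separable_pt_negativity rho_state rho_sep) ltxx in pt_gt0.
Qed.
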